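(* Fix $m\in\mathbb N$. Let $H$ be a graph with vertex set $\{v_1,\dots,v_k\}$, let $\mathcal F=\{G_1,\dots,G_k\}$ be a family of graphs with $V(G_i)=\{v_i^1,\dots,v_i^{n_i}\}$, and let $I_i:V(G_i)\to[m]$ ($1\le i\le k$) be indexing maps with indexing matrices $E_1,\dots,E_k$. Let $G$ be the $H_m$-join of $\mathcal F$ with respect to $I_1,\dots,I_k$. Let $\lambda$ be an eigenvalue of the graph $G_i$ (that is, of $A(G_i)$) with multiplicity $\mathrm{mult}_i(\lambda)$. Then the following hold for the spectrum of $A(G)$: (1) If $\lambda$ is an $E_i$-non-main eigenvalue of $A(G_i)$, then $\lambda$ is an eigenvalue of $A(G)$ with multiplicity at least $\mathrm{mult}_i(\lambda)$. (2) If $\lambda$ is an $E_i$-main eigenvalue of $A(G_i)$, then $\lambda$ is an eigenvalue of $A(G)$ with multiplicity at least $\mathrm{mult}_i(\lambda)-m$. (3) The remaining eigenvalues of $A(G)$ are the roots of the polynomial $\Phi(\lambda)\in\mathbb C[\lambda]$ defined in the context.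
   Context: All graphs are finite and simple. $A(G)$ denotes the adjacency matrix of $G$, and $[m]=\{1,\dots,m\}$. $H_m$-join: the graph with vertex set $\bigsqcup_{i=1}^k V(G_i)$ whose edges are all edges of all the $G_i$, together with all pairs $uv$ such that $u\in V(G_i)$, $v\in V(G_j)$, $v_iv_j\in E(H)$ and $I_i(u)=I_j(v)$. Indexing matrix: $E_i$ is the $n_i\times m$ matrix with $(E_i)_{st}=1$ if $I_i(v_i^s)=t$ and $0$ otherwise. $E$-main eigenvalues: for an $n\times n$ matrix $M$ and an $n\times m$ matrix $E$ over $\mathbb C$, an eigenvalue $\lambda$ of $M$ is $E$-main if its eigenspace is not orthogonal to the column space of $E$; otherwise it is $E$-non-main. The polynomial $\Phi$: let $\rho_{i,j}=1$ if $v_iv_j\in E(H)$ and $0$ otherwise. Let $\theta_i^1,\dots,\theta_i^{m_i}$ be the distinct $E_i$-main eigenvalues of $A(G_i)$ and $g_i=\prod_{j=1}^{m_i}(\lambda-\theta_i^j)$. Let $\Gamma_i=E_i^t(\lambda I_{n_i}-A(G_i))^{-1}E_i$; then $\Gamma_i=\frac1{g_i}f_i$, where $f_i$ is an $m\times m$ matrix with entries in $\mathbb C[\lambda]$. Define $$\Phi(\lambda)=\det\begin{bmatrix} g_1I_m&-\rho_{1,2}f_1&\cdots&-\rho_{1,k}f_1\\ -\rho_{2,1}f_2&g_2I_m&\cdots&-\rho_{2,k}f_2\\ \vdots&\vdots&\ddots&\vdots\\ -\rho_{k,1}f_k&-\rho_{k,2}f_k&\cdots&g_kI_m\end{bmat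rix}.$$
   Formalization: In (2), λ is claimed to be an eigenvalue of A(G) only if mult_i(λ)>m (two joined K_1, m=1, refute it otherwise); in (3), remaining eigenvalues are counted with signed multiplicities mult_i(λ)-m, since Φ may have roots that are not eigenvalues of A(G) when mult_i(λ)<m. *)

(* Defs.v *)
From HB Require Import structures.
From mathcomp Require Import all_boot all_order all_algebra.
From mathcomp Require Import sesquilinear spectral.

Set Implicit Arguments.
Unset Strict Implicit.
Unset Printing Implicit Defensive.

Import Order.TTheory GRing.Theory Num.Theory.
Import Num.Def.
Local Open Scope ring_scope.
Local Open Scope sesquilinear_scope.

Record sgraph (T : finType) := SGraph {
  adj :> rel T;
  adj_sym : symmetric adj;
  adj_irr : irreflexive adj
}.

(* Vertices are listed as enum_val 0, enum_val 1, ...; this is the labelling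
   used for the rows of both adjmx and indexmx. *)
Definition adjmx (C : numClosedFieldType) (T : finType) (G : sgraph T) :
    'M[C]_#|T| :=
  \matrix_(s, t) (G (enum_val s) (enum_val t))%:R.

Definition indexmx (C : numClosedFieldType) (T : finType) (m : nat)
    (I : T -> 'I_m) : 'M[C]_(#|T|, m) :=
  \matrix_(s, t) (I (enum_val s) == t)%:R.

Section Join.

Variables (k m : nat) (H : sgraph 'I_k) (V : 'I_k -> finType).
Variables (G : forall i, sgraph (V i)) (I : forall i, V i -> 'I_m).

(* When tag u = tag v, tagged_as u v is tagged v transported to V (tag u). *)
Definition hmjoin_adj : rel {i : 'I_k & V i} := fun u v =>
  ((tag u == tag v) && G (tag u) (tagged u) (tagged_as u v))
  || (H (tag u) (tag v) && (I (tagged u) == I (tagged v))).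

Lemma hmjoin_adj_sym : symmetric hmjoin_adj.
Proof.
move=> [i u] [j v]; rewrite /hmjoin_adj /= (adj_sym H) (eq_sym (I u)).
congr (_ || _); rewrite (eq_sym j); have [ij|//] := eqVneq i j.
by case: j / ij v => v; rewrite !tagged_asE adj_sym.
Qed.

Lemma hmjoin_adj_irr : irreflexive hmjoin_adj.
Proof.
by move=> [i u]; rewrite /hmjoin_adj /= tagged_asE !adj_irr andbF.
Qed.

Definition hmjoin : sgraph {i : 'I_k & V i} :=
  SGraph hmjoin_adj_sym hmjoin_adj_irr.

End Join.

Lemma invmx_diag (K : fieldType) n (P Q : 'M[K]_n) (v : 'rV[K]_n) :
  Q *m P = 1%:M -> P *m Q = 1%:M -> (forall j, v 0 j != 0) ->
  invmx (Q *m diag_mx v *m P) = Q *m diag_mx (\row_j (v 0 j)^-1) *m P.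
Proof.
move=> QP PQ v0; set X := Q *m diag_mx v *m P.
have prod1 : X *m (Q *m diag_mx (\row_j (v 0 j)^-1) *m P) = 1%:M.
  rewrite /X !mulmxA -(mulmxA _ P) PQ mulmx1 -(mulmxA Q) mulmx_diag.
  have -> : \row_j (v 0 j * (\row_j (v 0 j)^-1) 0 j) = const_mx 1.
    by apply/rowP => j; rewrite !mxE divff.
  by rewrite diag_const_mx mulmx1.
have [Xu _] := mulmx1_unit prod1.
by rewrite -[LHS]mulmx1 -prod1 mulKmx.
Qed.

Lemma row_diag_mul (K : fieldType) n p (d : 'rV[K]_n) (A : 'M[K]_(n, p)) j :
  row j (diag_mx d *m A) = d 0 j *: row j A.
Proof. by apply/rowP => t; rewrite mul_diag_mx !mxE. Qed.

Section Main.

Variable C : numClosedFieldType.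

(* Algebraic multiplicity; it is 0 when lam is not an eigenvalue. *)
Definition mult n (M : 'M[C]_n) (lam : C) : nat := mup lam (char_poly M).

Definition eigenvalues n (M : 'M[C]_n) : seq C :=
  undup (sval (closed_field_poly_normal (char_poly M))).

Lemma mem_eigenvalues n (M : 'M[C]_n) lam :
  (lam \in eigenvalues M) = eigenvalue M lam.
Proof.
rewrite /eigenvalues mem_undup eigenvalue_root_char.
case: closed_field_poly_normal => s /= defM.
by rewrite defM (monicP (char_poly_monic M)) scale1r root_prod_XsubC.
Qed.

(* eigenspace acts on row vectors, so the rows of eigenspace M^T lam span the
   transposes of the x with M x = lam x, and those of E^T the transposes of the
   column space of E; orthomx conjC 1%:M is the orthogonal complement for the
   standard Hermitian product. *)
Definition emain n m (M : 'M[C]_n) (E : 'M[C]_(n, m)) (lam : C) : bool :=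
  eigenvalue M lam && ~~ (eigenspace M^T lam <= orthomx conjC 1%:M E^T)%MS.

Definition enonmain n m (M : 'M[C]_n) (E : 'M[C]_(n, m)) (lam : C) : bool :=
  eigenvalue M lam && (eigenspace M^T lam <= orthomx conjC 1%:M E^T)%MS.

Definition main_poly n m (M : 'M[C]_n) (E : 'M[C]_(n, m)) : {poly C} :=
  \prod_(theta <- eigenvalues M | emain M E theta) ('X - theta%:P).

Local Notation frac := {fraction {poly C}}.
Local Notation tofrac := (@tofrac {poly C}).
Local Notation fracmx := (map_mx (tofrac \o polyC)).

Definition gamma n m (M : 'M[C]_n) (E : 'M[C]_(n, m)) : 'M[frac]_m :=
  (fracmx E)^T *m invmx (map_mx tofrac (char_poly_mx M)) *m fracmx E.

(* The polynomial represented by x, if there is one (see frac_polyK). *)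
Definition frac_poly (x : frac) : {poly C} := \n_(repr x) %/ \d_(repr x).

Lemma frac_polyK : cancel tofrac frac_poly.
Proof.
move=> p; rewrite /frac_poly.
have d0 := denom_ratioP (repr (tofrac p)).
suff -> : \n_(repr (tofrac p)) = p * \d_(repr (tofrac p)) by rewrite mulpK.
have -> : tofrac p = (\pi_frac (Ratio p 1))%qT by rewrite /FracField.tofrac -lock.
have := @FracField.equivf_l _ (Ratio p 1).
by rewrite !numden_Ratio ?oner_neq0 // mulr1 mulrC.
Qed.

(* The polynomial matrix f with gamma = f / g; see gammaE, gamma_adjmxE. *)
Definition main_numer n m (M : 'M[C]_n) (E : 'M[C]_(n, m)) : 'M[{poly C}]_m :=
  map_mx frac_poly (tofrac (main_poly M E) *: gamma M E).

Lemma gammaE n m (M : 'M[C]_n) (E : 'M[C]_(n, m)) : M \is normalmx ->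
  gamma M E = (tofrac (main_poly M E))^-1 *: map_mx tofrac (main_numer M E).
Proof.
move=> Mnormal.
have g0 : tofrac (main_poly M E) != 0.
  by rewrite tofrac_eq0 monic_neq0 // monic_prod_XsubC.
suff numerE s t : exists p, tofrac p =
    (tofrac (main_poly M E) *: gamma M E) s t.
  apply/matrixP => s t; rewrite !mxE -[LHS](mulKf g0); congr (_ * _).
  by have [p] := numerE s t; rewrite !mxE => <-; rewrite frac_polyK.
have defM := orthomx_spectralP Mnormal.
set P := spectralmx M in defM; set d := spectral_diag M in defM.
have Pu : P \in unitmx by apply: spectral_unit.
have Pstar : invmx P = P ^t* by rewrite invmx_unitary ?spectral_unitarymx.
pose w : 'rV[frac]_n := \row_j (tofrac ('X - (d 0 j)%:P))^-1.
pose PF := fracmx P; pose QF := fracmx (invmx P).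
have QP : QF *m PF = 1%:M by rewrite -map_mxM mulVmx // map_mx1.
have PQ : PF *m QF = 1%:M by rewrite -map_mxM mulmxV // map_mx1.
pose v : 'rV[frac]_n := \row_j tofrac ('X - (d 0 j)%:P).
have defX : map_mx tofrac (char_poly_mx M) = QF *m diag_mx v *m PF.
  have -> : v = const_mx (tofrac 'X) - fracmx d.
    by apply/rowP => j; rewrite !mxE rmorphB.
  rewrite linearB /= mulmxBr mulmxBl diag_const_mx -scalemx1.
  rewrite -scalemxAr mulmx1 -scalemxAl QP scalemx1 {1}defM.
  rewrite /char_poly_mx map_mxB /= map_scalar_mx; congr (_ - _).
  by rewrite -map_mx_comp !map_mxM map_diag_mx.
have v0 j : v 0 j != 0 by rewrite mxE tofrac_eq0 polyXsubC_eq0.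
have invX : invmx (map_mx tofrac (char_poly_mx M)) = QF *m diag_mx w *m PF.
  rewrite defX (invmx_diag QP PQ v0); congr (_ *m diag_mx _ *m _).
  by apply/rowP => j; rewrite [LHS]mxE [in LHS]mxE [RHS]mxE.
have PEE : fracmx (P *m E) = PF *m fracmx E by rewrite map_mxM.
rewrite /gamma invX !mulmxA -mulmxA -PEE mul_mx_diag.
set B := _ *m QF.
have BE : B = fracmx (E^T *m invmx P) by rewrite [RHS]map_mxM -map_trmx.
have term j : exists p, tofrac p = tofrac (main_poly M E) *
    ((tofrac ((E^T *m invmx P) s j)%:P) * w 0 j * tofrac ((P *m E) j t)%:P).
  have PM : P *m M = diag_mx d *m P by rewrite defM !mulmxA mulmxV // mul1mx.
  have rowM : row j P *m M = d 0 j *: row j P.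
    by rewrite -row_mul PM row_diag_mul.
  have rowP0 : row j P != 0.
    apply/eqP => r0; have := congr1 (row j) (mulmxV Pu).
    rewrite row_mul r0 mul0mx => /rowP /(_ j); rewrite !mxE eqxx => /eqP.
    by rewrite eq_sym oner_eq0.
  have evd : eigenvalue M (d 0 j) by apply/eigenvalueP; exists (row j P).
  have [dmain|] := boolP (emain M E (d 0 j)).
    exists ((\prod_(theta <- rem (d 0 j) (eigenvalues M) | emain M E theta)
      ('X - theta%:P)) * ((E^T *m invmx P) s j)%:P * ((P *m E) j t)%:P).
    rewrite /main_poly [in RHS](big_rem (d 0 j)) ?mem_eigenvalues //= dmain.
    rewrite !rmorphM mxE /= !mulrA; congr (_ * _).
    rewrite [RHS]mulrAC; congr (_ * _).
    have L0 : tofrac ('X - (d 0 j)%:P) != 0.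
      by rewrite tofrac_eq0 polyXsubC_eq0.
    by rewrite [w 0 j]mxE mulrAC (divff L0) mul1r.
  rewrite /emain evd negbK /= => sub.
  suff -> : (P *m E) j t = 0 by exists 0; rewrite !rmorph0 !mulr0.
  have Meig : (row j (map_mx conjC P) <= eigenspace M^T (d 0 j))%MS.
    have MQ : M *m invmx P = invmx P *m diag_mx d by rewrite {1}defM mulmxK.
    apply/eigenspaceP; rewrite Pstar in MQ; have := congr1 (fun X => row j X^T) MQ.
    rewrite !trmx_mul map_trmx trmxK tr_diag_mx row_diag_mul => <-.
    by rewrite row_mul.
  have := submx_trans Meig sub.
  rewrite /orthomx sub_kermx => /eqP /rowP /(_ t).
  rewrite mul1mx trmxK => e0; apply: (fmorph_inj conjC).
  rewrite rmorph0; move: e0; rewrite !mxE => e0; rewrite -[RHS]e0 rmorph_sum.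
  by apply: eq_bigr => l _; rewrite !mxE rmorphM.
have [q qE] := fin_all_exists term.
exists (\sum_j q j); rewrite rmorph_sum /= !mxE mulr_sumr.
by apply: eq_bigr => j _; rewrite qE BE !mxE.
Qed.

Lemma adjmx_normal (T : finType) (G : sgraph T) : adjmx C G \is normalmx.
Proof.
have sA : (adjmx C G)^T = adjmx C G.
  by apply/matrixP => s t; rewrite !mxE adj_sym.
have rA : map_mx conjC (adjmx C G) = adjmx C G.
  by apply/matrixP => s t; rewrite !mxE conjC_nat.
by apply/normalmxP; rewrite sA rA.
Qed.

Lemma gamma_adjmxE (T : finType) (m : nat) (G : sgraph T) (I : T -> 'I_m)
    (A := adjmx C G) (E := indexmx C I) :
  gamma A E = (tofrac (main_poly A E))^-1 *: map_mx tofrac (main_numer A E).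
Proof. exact/gammaE/adjmx_normal. Qed.

Definition join_poly (k m : nat) (H : sgraph 'I_k) (V : 'I_k -> finType)
    (G : forall i, sgraph (V i)) (I : forall i, V i -> 'I_m) : {poly C} :=
  \det (\mxblock_(i < k, j < k)
    (if i == j then (main_poly (adjmx C (G i)) (indexmx C (@I i)))%:M
     else - ((H i j)%:R *: main_numer (adjmx C (G i)) (indexmx C (@I i))))
    : 'M[{poly C}]_(\sum_(i < k) m)).

End Main.

(* Main.v *)
(* Ordering the vertices block by block, A(G) = D + U R U^T with D the block
   diagonal of the A(G_i), U that of the E_i and R = rho (x) I_m. Hence
   det(X - A(G)) = \prod_i det(X - A(G_i)) * det(1 - P Q) over C(X), and
   det(1 - P Q) = det(1 - Q P) turns the last factor into the determinant of
   1 - (rho_ij Gamma_i)_ij, which is Phi / \prod_i g_i^m. Comparing orders of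
   vanishing at lambda gives (3), as g_i has simple zeros, exactly at the E_i-main
   eigenvalues. For (1) and (2), an eigenvector x of A(G_i) with E_i^T x = 0,
   extended by zero, is an eigenvector of A(G); for real symmetric matrices
   algebraic and geometric multiplicities agree, and the condition E_i^T x = 0
   costs rank at most m, and nothing when lambda is E_i-non-main. *)

Require Import Defs.
From HB Require Import structures.
From mathcomp Require Import all_boot all_order all_algebra.
From mathcomp Require Import perm sesquilinear spectral.

Set Implicit Arguments.
Unset Strict Implicit.
Unset Printing Implicit Defensive.

Import Order.TTheory GRing.Theory Num.Theory.
Local Open Scope ring_scope.

(** * Root multiplicities, ranks, determinants of block matrices, and characteristic polynomials *)

Lemma mup_prod (F : fieldType) (I : Type) (r : seq I) (P : pred I)
    (p : I -> {poly F}) x : (forall i, P i -> p i != 0) ->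
  mup x (\prod_(i <- r | P i) p i) = (\sum_(i <- r | P i) mup x (p i))%N.
Proof.
move=> p0; elim: r => [|i r IHr]; first by rewrite !big_nil mupNroot ?root1.
rewrite !big_cons; case: ifP => // Pi.
rewrite mupM ?IHr ?p0 //.
by elim/big_ind: _ => //; [apply: oner_neq0 | apply: mulf_neq0].
Qed.

Lemma mxrank_diag (F : fieldType) n (d : 'rV[F]_n) :
  \rank (diag_mx d) = (\sum_j (d ord0 j != 0)%R)%N.
Proof.
elim: n d => [|n IHn] d; first by rewrite flatmx0 mxrank0 big_ord0.
rewrite -[n.+1]/(1 + n)%N in d *; rewrite -[d]hsubmxK diag_mx_row.
rewrite rank_diag_block_mx IHn big_split_ord big_ord1 /=.
rewrite row_mxEl; under [in RHS]eq_bigr do rewrite row_mxEr.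
congr (_ + _)%N; set a := lsubmx d.
rewrite [diag_mx a]mx11_scalar rank_rV mxE eqxx mulr1n.
by rewrite -[RHS]/(nat_of_bool _) -scalemx1 scaler_eq0 oner_eq0 orbF.
Qed.

(** Sylvester's identity: multiplying [block_mx 1%:M P Q 1%:M] by the same unipotent factor on the
    right or on the left makes it block triangular, with [1%:M - P *m Q] or [1%:M - Q *m P] as the
    nontrivial diagonal block. *)
Lemma det_1subM (R : comPzRingType) m n (P : 'M[R]_(m, n)) (Q : 'M_(n, m)) :
  \det (1%:M - P *m Q) = \det (1%:M - Q *m P).
Proof.
have ulE : block_mx 1%:M P Q 1%:M *m block_mx 1%:M 0 (- Q) 1%:M
    = block_mx (1%:M - P *m Q) P 0 1%:M.
  by rewrite mulmx_block !mulmx1 !mul1mx !mulmx0 mulmxN add0r addrN add0r.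
have lrE : block_mx 1%:M 0 (- Q) 1%:M *m block_mx 1%:M P Q 1%:M
    = block_mx 1%:M P 0 (1%:M - Q *m P).
  rewrite mulmx_block !mulmx1 !mul1mx !mul0mx mulNmx !addr0 addNr.
  by rewrite addrC.
have := congr1 determinant ulE; rewrite det_mulmx mulrC -det_mulmx lrE.
by rewrite !det_ublock !det1 mul1r mulr1.
Qed.

Lemma det_mxdiag (R : comPzRingType) k (n : 'I_k -> nat)
    (B : forall i, 'M[R]_(n i)) :
  \det (\mxdiag_i B i) = \prod_i \det (B i).
Proof.
elim: k n B => [|k IHk] n B.
  (* The size is an empty sum, so the matrix is generalised before the size is rewritten to 0. *)
  by move: (\mxdiag_ _ _); rewrite !big_ord0 => M; rewrite det_mx00.
rewrite mxdiag_recl [RHS]big_ord_recl -IHk.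
by case: _ / mxsize_recl; rewrite castmx_id det_ublock.
Qed.

Lemma map_mxblock (aT rT : Type) (f : aT -> rT) p q (m : 'I_p -> nat)
    (n : 'I_q -> nat) (B : forall i j, 'M[aT]_(m i, n j)) :
  map_mx f (\mxblock_(i, j) B i j) = \mxblock_(i, j) map_mx f (B i j).
Proof. by apply/matrixP => s t; rewrite !mxE. Qed.

Lemma map_mxdiag (aT rT : nmodType) (f : {additive aT -> rT}) p
    (n : 'I_p -> nat) (B : forall i, 'M[aT]_(n i)) :
  map_mx f (\mxdiag_i B i) = \mxdiag_i map_mx f (B i).
Proof.
rewrite map_mxblock; apply/eq_mxblock => i j.
by case: eqVneq => [<-|_]; rewrite ?conform_mx_id ?map_mx0.
Qed.

(** The bijection forces [n' = n]; it then permutes rows and columns alike, so the two signs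
    cancel. *)
Lemma char_poly_mxsub (R : comNzRingType) n n' (f : 'I_n' -> 'I_n)
    (A : 'M[R]_n) : bijective f -> char_poly (mxsub f f A) = char_poly A.
Proof.
move=> bij_f; have := bij_eq_card bij_f; rewrite !card_ord => eq_n.
case: n / eq_n in f A bij_f *; set s := perm (bij_inj bij_f).
have -> : mxsub f f A = row_perm s (col_perm s A).
  by apply/matrixP => i j; rewrite !mxE !permE.
rewrite /char_poly; set B := char_poly_mx A.
have -> : char_poly_mx (row_perm s (col_perm s A)) = row_perm s (col_perm s B).
  by apply/matrixP => i j; rewrite !mxE (inj_eq perm_inj).
rewrite row_permE col_permE !det_mulmx !det_perm odd_permV mulrCA.
by rewrite -signr_addb addbb mulr1.
Qed.

Lemma char_poly_conj (R : comUnitRingType) n (P A : 'M[R]_n) :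
  P \in unitmx -> char_poly (invmx P *m A *m P) = char_poly A.
Proof.
move=> Pu; rewrite /char_poly.
have -> : char_poly_mx (invmx P *m A *m P)
    = map_mx polyC (invmx P) *m char_poly_mx A *m map_mx polyC P.
  rewrite /char_poly_mx mulmxBr mulmxBl -!map_mxM -scalemx1.
  rewrite -scalemxAr mulmx1 -scalemxAl.
  by rewrite -map_mxM mulVmx // map_mx1.
rewrite !det_mulmx mulrAC -det_mulmx -map_mxM mulVmx // map_mx1 det1.
by rewrite mul1r.
Qed.

(** * Multiplicities for normal matrices, and main eigenvalues *)

Section Multiplicity.

Variable C : numClosedFieldType.

Lemma eigenvalue_mult n (M : 'M[C]_n) lam :
  eigenvalue M lam = (0 < mult M lam)%N.
Proof.
rewrite eigenvalue_root_char /mult -XsubC_dvd ?dvdp_XsubCl //.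
exact/monic_neq0/char_poly_monic.
Qed.

(** After unitary diagonalisation both sides count the diagonal entries equal to [lam]. *)
Lemma mult_normal n (M : 'M[C]_n) lam : M \is normalmx ->
  mult M lam = \rank (eigenspace M lam).
Proof.
move=> /orthomx_spectralP; set P := spectralmx M; set d := spectral_diag M.
have Pu : P \in unitmx by apply: spectral_unit.
move=> defM; rewrite /mult {1}defM char_poly_conj //.
rewrite char_poly_trig ?diag_mx_is_trig // mup_prod => [|i _]; last first.
  by rewrite polyXsubC_eq0.
rewrite /eigenspace mxrank_ker.
have -> : M - lam%:M = invmx P *m diag_mx (d - const_mx lam) *m P.
  rewrite linearB /= diag_const_mx mulmxBr mulmxBl -defM.
  by rewrite scalar_mxC mulmxKV.
rewrite mxrankMfree ?row_free_unit // eqmxMfull; last first.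
  by rewrite row_full_unit unitmx_inv.
have nE : n = (\sum_j (d ord0 j != lam) + \sum_j (d ord0 j == lam))%N.
  rewrite -big_split -[LHS]card_ord -sum1_card; apply: eq_bigr => j _.
  by case: eqP.
rewrite mxrank_diag [X in (X - _)%N]nE.
under [X in (_ - X)%N]eq_bigr do rewrite !mxE subr_eq0.
rewrite addKn; apply: eq_bigr => j _.
by rewrite mxE eqxx mulr1n (@mup_XsubCX _ 1); case: eqP.
Qed.

Lemma main_poly_neq0 n m (M : 'M[C]_n) (E : 'M[C]_(n, m)) : main_poly M E != 0.
Proof. by rewrite monic_neq0 // monic_prod_XsubC. Qed.

Lemma mup_main_poly n m (M : 'M[C]_n) (E : 'M[C]_(n, m)) lam :
  mup lam (main_poly M E) = emain M E lam.
Proof.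
rewrite /main_poly -big_filter mu_prod_XsubC count_uniq_mem; last first.
  by rewrite filter_uniq // undup_uniq.
by rewrite mem_filter mem_eigenvalues /emain; case: eigenvalue; rewrite ?andbT.
Qed.

Lemma tr_adjmx (T : finType) (G : sgraph T) : (adjmx C G)^T = adjmx C G.
Proof. by apply/matrixP => s t; rewrite !mxE adj_sym. Qed.

(** The entries of [indexmx] are 0 or 1, so conjugation disappears and orthogonality becomes a
    linear condition. *)
Lemma eigenspace_ortho_indexmx (T : finType) m (M : 'M[C]_#|T|)
    (I : T -> 'I_m) lam :
  (eigenspace M lam <= orthomx Num.conj 1%:M (indexmx C I)^T)%MS
  = (eigenspace M lam *m indexmx C I == 0).
Proof.
rewrite orthomx1E trmxK; congr (_ *m _ == 0).
by apply/matrixP => s t; rewrite !mxE conjC_nat.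
Qed.

End Multiplicity.

(** * The adjacency matrix of the join: embedded eigenvectors, block form, determinant identity *)

Section Join.

Variables (C : numClosedFieldType) (m k : nat) (H : sgraph 'I_k).
Variables (V : 'I_k -> finType) (G : forall i, sgraph (V i)).
Variable I : forall i, V i -> 'I_m.

Local Notation AG := (adjmx C (hmjoin H G I)).
Local Notation A := (fun i => adjmx C (G i)).
Local Notation E := (fun i => indexmx C (@I i)).
Local Notation Phi := (join_poly C H G I).
Local Notation tofrac := (@tofrac {poly C}).
Local Notation fracmx := (map_mx (tofrac \o polyC)).

Let inj_vertex i (s : 'I_#|V i|) : 'I_#|{: {i & V i}}| :=
  enum_rank (Tagged V (enum_val s)).

Let enum_vertexK i (s : 'I_#|V i|) :
  enum_val (inj_vertex s) = Tagged V (enum_val s).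
Proof. exact: enum_rankK. Qed.

(** Edges inside [G i] give the first term, [rowsub _ 1%:M] being extension by zero; the join edges
    at a vertex of [G i] depend only on its index, so they factor through [E i]. *)
Lemma adjmx_join_row i :
  exists K, rowsub (@inj_vertex i) AG
    = A i *m rowsub (@inj_vertex i) 1%:M + E i *m K.
Proof.
(* Row [l] marks the vertices to which a vertex of [G i] of index [l] is joined across [H]. *)
exists (\matrix_(l, t) (H i (tag (enum_val t))
  && (l == I (tagged (enum_val t))))%:R).
apply/matrixP => s t; rewrite !mxE enum_vertexK /=.
under eq_bigr do rewrite !mxE; under [X in _ + X]eq_bigr do rewrite !mxE.
rewrite -[t]enum_valK; case: (enum_val t) => j v; rewrite enum_rankK /=.
rewrite /hmjoin_adj /=.
rewrite [X in _ + X](bigD1 (I (enum_val s))) //= eqxx mul1r.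
rewrite [X in _ + (_ + X)]big1 ?addr0; last first.
  by move=> l; rewrite eq_sym => /negPf ->; rewrite mul0r.
have [ij|ij] := eqVneq i j; last first.
  rewrite big1 ?add0r // => r _; rewrite (can_eq enum_rankK).
  by rewrite -tag_eqE /tag_eq /= (negPf ij) mulr0.
case: j / ij v => v; rewrite tagged_asE adj_irr orbF /= addr0.
rewrite (bigD1 (enum_rank v)) //= /inj_vertex enum_rankK eqxx mulr1.
rewrite big1 ?addr0 // => r; rewrite (can_eq enum_rankK) eq_Tagged /=.
by rewrite -(can_eq enum_valK) enum_rankK => /negPf ->; rewrite mulr0.
Qed.

(** Row vectors of the eigenspace killed by [E i], extended by zero, lie in the eigenspace of the
    join; rank-nullity shows that restricting to them costs exactly the last rank. *)
Lemma mult_join_ge i lam :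
  (mult (A i) lam
    <= mult AG lam + \rank (eigenspace (A i) lam *m E i))%N.
Proof.
have [K AGK] := adjmx_join_row i.
rewrite !mult_normal ?adjmx_normal // -(mxrank_mul_ker _ (E i)) addnC leq_add2r.
set J := rowsub (@inj_vertex i) 1%:M in AGK; set W := (_ :&: _)%MS.
have J_free : row_free J.
  apply/row_freeP; exists (colsub (@inj_vertex i) 1%:M).
  rewrite -mxsub_mul mulmx1; apply/matrixP => s t; rewrite !mxE.
  by rewrite (can_eq enum_rankK) eq_Tagged /= (can_eq enum_valK).
rewrite -(mxrankMfree _ J_free); apply/mxrankS/eigenspaceP.
have /eigenspaceP WA : (W <= eigenspace (A i) lam)%MS by apply: capmxSl.
have /sub_kermxP WE : (W <= kermx (E i))%MS by apply: capmxSr.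
by rewrite -mulmxA -rowsubE AGK mulmxDr !mulmxA WA WE mul0mx addr0 -scalemxAl.
Qed.

(** The block-by-block ordering of the vertices, which need not be the enumeration order used by
    [adjmx]. *)
Let vertices : 'I_(\sum_i #|V i|) -> 'I_#|{: {i & V i}}| :=
  fun s => inj_vertex (tagnat.sig2 s).

Let vertices_bij : bijective vertices.
Proof.
pose rk (u : {i & V i}) :=
  @tagnat.Rank k (fun i => #|V i|) (tag u) (enum_rank (tagged u)).
exists (rk \o enum_val) => s; rewrite /vertices /rk /=.
  by rewrite enum_vertexK /= enum_valK tagnat.sig2K.
rewrite -[RHS]enum_valK; case: (enum_val s) => i u /=.
rewrite /inj_vertex /tagnat.sig2 /tagnat.sig1 /tagnat.Rank.
by rewrite tagnat.rankK /= enum_rankK.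
Qed.

(** An entry of [E i *m (E j)^T] tells whether two indices agree; since [H] has no loops, the second
    summand does not touch the diagonal blocks. *)
Lemma adjmx_join_block :
  mxsub vertices vertices AG
  = \mxdiag_i A i + \mxblock_(i, j) ((H i j)%:R *: (E i *m (E j)^T)).
Proof.
rewrite -mxblockD; apply/mxblockP => i j; rewrite mxblockK.
apply/matrixP => s t; rewrite !mxE /vertices.
rewrite /inj_vertex /tagnat.sig2 /tagnat.sig1 /tagnat.Rank !tagnat.rankK /=.
rewrite !enum_rankK /= /hmjoin_adj /=.
rewrite (bigD1 (I (enum_val s))) //= !mxE eqxx mul1r big1 ?addr0; last first.
  by move=> l; rewrite eq_sym !mxE => /negPf ->; rewrite mul0r.
rewrite -natrM mulnb [I _ == I _]eq_sym.
have [ij|_] := eqVneq i j; last by rewrite mxE add0r.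
case: j / ij t => t; rewrite conform_mx_id tagged_asE adj_irr orbF addr0.
by rewrite !mxE.
Qed.

(** In the fraction field, where every [X i] is invertible, [Phi] and the characteristic polynomial
    of the join share one determinant factor; this is the relation with denominators cleared. *)
Lemma join_poly_char_poly :
  Phi * \prod_i char_poly (A i)
  = \prod_i main_poly (A i) (E i) ^+ m * char_poly AG.
Proof.
apply: (can_inj (@frac_polyK C)); rewrite !rmorphM !rmorph_prod /=.
pose X i := map_mx tofrac (char_poly_mx (A i)).
pose g i := main_poly (A i) (E i).
pose Y i := tofrac (g i).
(* [P *m Q] is the off-diagonal part of the join. The blocks of [Q] are rectangular, so its block
   diagonal form is spelled out with zeros. *)
pose P := \mxblock_(i, j) ((H i j)%:R *: fracmx (E i)).
pose Q := \mxblock_(i < k, j < k) (if i == j then (fracmx (E j))^T else 0).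
have Xu i : X i \in unitmx.
  rewrite unitmxE det_map_mx unitfE tofrac_eq0.
  exact/monic_neq0/char_poly_monic.
have PhiE : tofrac Phi = \prod_i Y i ^+ m
    * \det (1%:M - Q *m (\mxdiag_i invmx (X i) *m P)).
  (* The powers [Y i ^+ m] become the determinant of a block scalar matrix, which multiplies the
     [i]-th block row by [g i] and so clears the denominator of [gamma]. *)
  rewrite -[\prod_i _](eq_bigr _ (fun i _ => det_scalar m (Y i))).
  rewrite -det_mxdiag -det_mulmx -det_map_mx map_mxblock; congr (\det _).
  rewrite /P mul_mxdiag_mxblock /Q mul_mxblock -mxdiagZ -mxblockB.
  rewrite mul_mxdiag_mxblock; apply/eq_mxblock => i j.
  rewrite (bigD1 i) //= eqxx big1 ?addr0 => [|l li]; last first.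
    by rewrite eq_sym (negPf li) mul0mx.
  rewrite -!scalemxAr mulmxA -/(gamma (A i) (E i)) gamma_adjmxE -/(g i).
  rewrite mulmxBr -!scalemxAr !mul_scalar_mx [_^-1 *: _]scalerA mulVf ?scale1r;
    last first.
    by rewrite tofrac_eq0 main_poly_neq0.
  have [<-|_] := eqVneq i j.
    by rewrite adj_irr scale0r subr0 conform_mx_id map_scalar_mx scalemx1.
  rewrite scaler0 sub0r map_mxN map_mxZ; congr (- (_ *: _)).
  by rewrite rmorph_nat.
have charE : tofrac (char_poly AG) = \prod_i \det (X i)
    * \det (1%:M - Q *m (\mxdiag_i invmx (X i) *m P)).
  rewrite -(char_poly_mxsub _ vertices_bij) adjmx_join_block.
  (* Sylvester's identity moves [Q] to the right, and the block diagonal of the [X i] is then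
     multiplied in. *)
  rewrite -det_map_mx -det_1subM -det_mxdiag -det_mulmx; congr (\det _).
  have LP : \mxdiag_i X i *m (\mxdiag_i invmx (X i) *m P) = P.
    rewrite /P !mul_mxdiag_mxblock; apply/eq_mxblock => i j.
    by rewrite mulKVmx.
  have PQ : P *m Q
      = fracmx (\mxblock_(i, j) ((H i j)%:R *: (E i *m (E j)^T))).
    rewrite map_mxblock /P /Q mul_mxblock; apply/eq_mxblock => i j.
    rewrite (bigD1 j) //= eqxx big1 ?addr0 => [|l /negPf ->]; last first.
      by rewrite mulmx0.
    by rewrite map_mxZ map_mxM map_trmx rmorph_nat -scalemxAl.
  rewrite mulmxBr mulmx1 mulmxA LP PQ map_mx_comp -map_mxdiag -map_mxB.
  congr (map_mx _ _); rewrite /char_poly_mx map_mxD opprD addrA; congr (_ - _).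
  by rewrite -mxdiagZ map_mxdiag mxdiagB.
rewrite PhiE charE mulrAC -!mulrA; congr (_ * _).
  by apply: eq_bigr => i _; rewrite rmorphXn.
by congr (_ * _); apply: eq_bigr => i _; rewrite det_map_mx.
Qed.

End Join.


Theorem theorem3 (C : numClosedFieldType) (m k : nat) (H : sgraph 'I_k)
    (V : 'I_k -> finType) (G : forall i : 'I_k, sgraph (V i))
    (I : forall i : 'I_k, V i -> 'I_m) :
  let AG := adjmx C (hmjoin H G I) in
  let A := fun i : 'I_k => adjmx C (G i) in
  let E := fun i : 'I_k => indexmx C (I i) in
  let Phi := join_poly C H G I in
  [/\ forall (i : 'I_k) (lam : C), eigenvalue (A i) lam ->
        enonmain (A i) (E i) lam ->
        eigenvalue AG lam /\ (mult (A i) lam <= mult AG lam)%N,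
      forall (i : 'I_k) (lam : C), eigenvalue (A i) lam ->
        emain (A i) (E i) lam ->
        ((m < mult (A i) lam)%N -> eigenvalue AG lam)
        /\ (mult (A i) lam)%:Z - m%:Z <= (mult AG lam)%:Z
    & Phi != 0 /\
      forall lam : C,
        (mup lam Phi)%:Z =
        (mult AG lam)%:Z
        - \sum_(i < k) (if emain (A i) (E i) lam then (mult (A i) lam)%:Z - m%:Z
                        else (mult (A i) lam)%:Z)].
Proof.
move=> AG A E Phi.
have key := join_poly_char_poly C H G I; rewrite -/AG -/Phi in key.
have ge i lam := @mult_join_ge C m k H V G I i lam; rewrite -/AG in ge.
have char0 n (M : 'M[C]_n) : char_poly M != 0.
  exact/monic_neq0/char_poly_monic.
have prodg0 : \prod_i main_poly (A i) (E i) ^+ m != 0.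
  by apply/prodf_neq0 => i _; rewrite expf_neq0 // main_poly_neq0.
have prodc0 : \prod_i char_poly (A i) != 0 by apply/prodf_neq0.
have Phi0 : Phi != 0.
  have : Phi * \prod_i char_poly (A i) != 0 by rewrite key mulf_neq0.
  by rewrite mulf_eq0 negb_or => /andP[].
split=> [i lam ev|i lam ev|].
(* Non-main means that [E i] kills the eigenspace, so the rank lost is 0. *)
- rewrite /enonmain ev tr_adjmx eigenspace_ortho_indexmx /= => /eqP E0.
  have := ge i lam; rewrite -/(A i) -/(E i) E0 mxrank0 addn0 => le.
  split=> //; rewrite eigenvalue_mult (leq_trans _ le) //.
  by rewrite -eigenvalue_mult.
(* A matrix with [m] columns has rank at most [m]. *)
- move=> _; have le : (mult (A i) lam <= mult AG lam + m)%N.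
    by rewrite (leq_trans (ge i lam)) // leq_add2l rank_leq_col.
  split; last by rewrite lerBlDr -PoszD.
  by move=> lt; rewrite eigenvalue_mult -(ltn_add2r m) add0n (leq_trans lt).
(* Compare the orders of vanishing at [lam] on both sides of [key]. *)
- split=> // lam; have := congr1 (mup lam) key.
  rewrite !mupM // !mup_prod //; last first.
    by move=> i _; rewrite expf_neq0 // main_poly_neq0.
  have mup_g i : mup lam (main_poly (A i) (E i) ^+ m)
      = (emain (A i) (E i) lam * m)%N.
    (* The power is viewed as a constant product over ['I_m], to which [mup_prod] applies. *)
    rewrite -[m in _ ^+ m]card_ord -prodr_const mup_prod => [|j _]; last first.
      exact: main_poly_neq0.
    by rewrite sum_nat_const card_ord mup_main_poly mulnC.
  (* The count passes to integers because a multiplicity minus [m] may be negative. *)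
  rewrite (eq_bigr _ (fun i _ => mup_g i)) => /(congr1 Posz).
  rewrite !PoszD !(big_morph Posz PoszD (erefl 0)) => keyZ.
  rewrite (eq_bigr (fun i => (mult (A i) lam)%:Z
    - (emain (A i) (E i) lam * m)%N%:Z)) => [|i _]; last first.
    by case: emain; rewrite ?mul1n ?subr0.
  by rewrite sumrB opprB addrCA addrA -keyZ addrK.
Qed.
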